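(* Let $k$ be an integer with $k\ge2$. Then $$B_{1,\omega_{\mathbf{p}}^{-k}}=(k+2)\widehat{B}_{\mathbf{p}-k}-(k+1)\widehat{B}_{2\mathbf{p}-k-1}\quad\text{in }\mathcal{A}_2,$$ $$B_{1,\omega_{\mathbf{p}}^{-k}}=\widehat{B}_{\mathbf{p}-k}\quad\text{in }\mathcal{A}.$$
   Context: For $n\ge1$, $\mathcal{A}_n=\left(\prod_p\mathbb{Z}/p^n\mathbb{Z}\right)/\left(\bigoplus_p\mathbb{Z}/p^n\mathbb{Z}\right)$, $p$ running over all primes, and $\mathcal{A}=\mathcal{A}_1$. Elements are written $(a_p)_p$; two are equal iff their components agree for all but finitely many $p$ (so components may be undefined for finitely many $p$). $B_m$ is the $m$-th Bernoulli number, $\frac{te^t}{e^t-1}=\sum_{m\ge0}B_m\frac{t^m}{m!}$, and $\widehat{B}_m=B_m/m$ for $m\ge1$. In $\mathcal{A}_n$, $\widehat{B}_{\mathbf{p}-k}=(\widehat{B}_{p-k}\bmod p^n)_p$ and $\widehat{B}_{2\mathbf{p}-k-1}=(\widehat{B}_{2p-k-1}\bmod p^n)_p$ (these rational numbers are $p$-integral for all large $p$). For a Dirichlet character $\chi$ modulo $N$, the generalized Bernoulli numbers are defined by $\sum_{a=1}^N\frac{\chi(a)te^{at}}{e^{Nt}-1}=\sum_{n\ge0}B_{n,\chi}\frac{t^n}{n!}$; for nontrivial $\chi$, $B_{1,\chi}=\frac1N\sum_{a=1}^N\chi(a)a$. $\omega_p:(\mathbb{Z}/p\mathbb{Z})^{\times}\to\mathbb{Z}_p^{\times}$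 is the Teichmüller character, so $B_{1,\omega_p^{-k}}\in\mathbb{Z}_p$ for all large $p$, and $B_{1,\omega_{\mathbf{p}}^{-k}}=(B_{1,\omega_p^{-k}}\bmod p^n)_p\in\mathcal{A}_n$. *)

(* Defs.v *)
From HB Require Import structures.
From mathcomp Require Import all_boot all_order all_algebra.
From mathcomp Require Import cyclic all_classical ring.

Set Implicit Arguments.
Unset Strict Implicit.
Unset Printing Implicit Defensive.

Import Order.TTheory GRing.Theory Num.Theory.

Local Open Scope ring_scope.
Local Open Scope quotient_scope.

(* The alias keeps these instances apart from those that MathComp-Analysis
   puts on non-dependent function types. *)
Definition dprod (I : Type) (K : I -> Type) := forall i, K i.

Section DprodRing.
Variables (I : pointedType) (K : I -> comNzRingType).
Implicit Types x y z : dprod K.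

HB.instance Definition _ := gen_eqMixin (dprod K).
HB.instance Definition _ := gen_choiceMixin (dprod K).

Let zero : dprod K := fun=> 0.
Let one : dprod K := fun=> 1.
Let opp x : dprod K := fun i => - x i.
Let add x y : dprod K := fun i => x i + y i.
Let mul x y : dprod K := fun i => x i * y i.

Let addA : associative add.
Proof. by move=> x y z; apply: functional_extensionality_dep => i; apply: addrA. Qed.
Let addC : commutative add.
Proof. by move=> x y; apply: functional_extensionality_dep => i; apply: addrC. Qed.
Let add0 : left_id zero add.
Proof. by move=> x; apply: functional_extensionality_dep => i; apply: add0r. Qed.
Let addN : left_inverse zero opp add.
Proof. by move=> x; apply: functional_extensionality_dep => i; apply: addNr. Qed.

HB.instance Definition _ := GRing.isZmodule.Build (dprod K) addA addC add0 addN.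

Let mulA : associative mul.
Proof. by move=> x y z; apply: functional_extensionality_dep => i; apply: mulrA. Qed.
Let mulC : commutative mul.
Proof. by move=> x y; apply: functional_extensionality_dep => i; apply: mulrC. Qed.
Let mul1 : left_id one mul.
Proof. by move=> x; apply: functional_extensionality_dep => i; apply: mul1r. Qed.
Let mulD : left_distributive mul +%R.
Proof. by move=> x y z; apply: functional_extensionality_dep => i; apply: mulrDl. Qed.
Let one_neq0 : one != 0.
Proof.
apply/eqP => /(congr1 (fun f : dprod K => f point)) /eqP.
by rewrite (negPf (oner_neq0 _)).
Qed.

HB.instance Definition _ :=
  GRing.Zmodule_isComNzRing.Build (dprod K) mulA mulC mul1 mulD one_neq0.

Lemma dprod0E i : (0 : dprod K) i = 0. Proof. by []. Qed.
Lemma dprod1E i : (1 : dprod K) i = 1. Proof. by []. Qed.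
Lemma dprodDE x y i : (x + y) i = x i + y i. Proof. by []. Qed.
Lemma dprodNE x i : (- x) i = - x i. Proof. by []. Qed.
Lemma dprodME x y i : (x * y) i = x i * y i. Proof. by []. Qed.

End DprodRing.

Record primeNum := PrimeNum { prime_val :> nat; prime_valP : prime prime_val }.

HB.instance Definition _ := [isSub for prime_val].
HB.instance Definition _ := [Choice of primeNum by <:].
HB.instance Definition _ := isPointed.Build primeNum (@PrimeNum 2 isT).

Section Reduction.
Variable p : primeNum.

Lemma Zp_modulus n : (0 < n)%N -> (Zp_trunc (p ^ n)).+2 = (p ^ n)%N.
Proof.
case: n => // n _; apply: Zp_cast; apply: (@leq_trans p).
  exact/prime_gt1/prime_valP.
by rewrite expnS leq_pmulr // expn_gt0 prime_gt0 // prime_valP.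
Qed.

Lemma expn_prime_gt1 n : (0 < n)%N -> (1 < p ^ n)%N.
Proof. by move/Zp_modulus <-. Qed.

Lemma Zp_natP n a b : (0 < n)%N ->
  reflect (a%:R = b%:R :> 'Z_(p ^ n)) (a == b %[mod p ^ n])%N.
Proof.
move=> n_gt0; apply: (iffP eqP) => [eq_ab | eq_ab].
  apply: val_inj => /=; rewrite val_Zp_nat ?expn_prime_gt1 //.
  by rewrite val_Zp_nat ?expn_prime_gt1.
have := congr1 (fun u : 'Z_(p ^ n) => u : nat) eq_ab.
by rewrite val_Zp_nat ?expn_prime_gt1 // val_Zp_nat ?expn_prime_gt1.
Qed.

Definition Zp_red m n (u : 'Z_(p ^ m)) : 'Z_(p ^ n) := (u : nat)%:R.

Lemma Zp_red_nat m n a : (0 < n <= m)%N ->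
  Zp_red n (a%:R : 'Z_(p ^ m)) = a%:R.
Proof.
case/andP=> n_gt0 le_nm; apply/Zp_natP => //.
rewrite val_Zp_nat ?expn_prime_gt1 ?(leq_trans n_gt0) //.
by rewrite modn_dvdm // dvdn_exp2l.
Qed.

Lemma Zp_redD m n : (0 < n <= m)%N -> {morph @Zp_red m n : u v / u + v}.
Proof.
move=> nm u v; rewrite -[u in LHS]natr_Zp -[v in LHS]natr_Zp -natrD.
by rewrite Zp_red_nat // natrD.
Qed.

Lemma Zp_redM m n : (0 < n <= m)%N -> {morph @Zp_red m n : u v / u * v}.
Proof.
move=> nm u v; rewrite -[u in LHS]natr_Zp -[v in LHS]natr_Zp -natrM.
by rewrite Zp_red_nat // natrM.
Qed.

Lemma Zp_red1 m n : (0 < n <= m)%N -> @Zp_red m n 1 = 1.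
Proof. by move=> nm; rewrite -[1]/(1%:R) Zp_red_nat. Qed.

Lemma Zp_redN m n : (0 < n <= m)%N -> {morph @Zp_red m n : u / - u}.
Proof.
move=> nm u; apply: (addrI (Zp_red n u)); rewrite -Zp_redD // !subrr.
by rewrite -[0 in LHS]/(0%:R) Zp_red_nat.
Qed.

Lemma Zp_red_trans l m n (u : 'Z_(p ^ l)) : (0 < n <= m)%N ->
  Zp_red n (Zp_red m u) = Zp_red n u.
Proof. by move=> nm; rewrite {2}/Zp_red Zp_red_nat. Qed.

Lemma Zp_red_id n (u : 'Z_(p ^ n)) : Zp_red n u = u.
Proof. exact: natr_Zp. Qed.

End Reduction.

(* Z_p is the inverse limit of the rings Z/p^n, n >= 1; component i of a
   coherent sequence lives in Z/p^(i+1). *)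
Section PadicIntegers.
Variable p : primeNum.

Definition padic_prod := dprod (fun i => 'Z_(p ^ i.+1)).
HB.instance Definition _ := GRing.ComNzRing.on padic_prod.

Definition coherent : {pred padic_prod} :=
  [pred x | `[< forall i, Zp_red i.+1 (x i.+1) = x i >]].

Lemma coherentP (x : padic_prod) :
  reflect (forall i, Zp_red i.+1 (x i.+1) = x i) (x \in coherent).
Proof. exact: asboolP. Qed.

Let bnd i : (0 < i.+1 <= i.+2)%N. Proof. by rewrite leqnSn. Qed.

Lemma coherent_subring : subring_closed coherent.
Proof.
split=> [|x y /coherentP xP /coherentP yP|x y /coherentP xP /coherentP yP];
  apply/coherentP => i.
- exact: Zp_red1.
- by rewrite -[(x - y) i]/(x i - y i) -xP -yP -Zp_redN // -Zp_redD.
- by rewrite -[(x * y) i]/(x i * y i) -xP -yP -Zp_redM.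
Qed.

HB.instance Definition _ :=
  GRing.isSubringClosed.Build padic_prod coherent coherent_subring.

Record padic_int := PadicInt { padic_seq : padic_prod; _ : padic_seq \in coherent }.

HB.instance Definition _ := [isSub for padic_seq].
HB.instance Definition _ := [Choice of padic_int by <:].
HB.instance Definition _ := [SubChoice_isSubComNzRing of padic_int by <:].

Definition padic_comp (x : padic_int) : forall i, 'Z_(p ^ i.+1) := padic_seq x.
Coercion padic_comp : padic_int >-> Funclass.

Implicit Types x y : padic_int.

Lemma padic_coherent x i j : (i <= j)%N -> Zp_red i.+1 (x j) = x i.
Proof.
elim: j => [|j IHj]; first by rewrite leqn0 => /eqP ->; apply: Zp_red_id.
rewrite leq_eqVlt => /predU1P[-> | lt_ij]; first exact: Zp_red_id.
have /coherentP/(_ j) xj := valP x.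
by rewrite -(IHj lt_ij) -[x j]xj Zp_red_trans.
Qed.

Let unit_pred : {pred padic_int} := [pred x | `[< exists y, y * x = 1 >]].

Let unit_sig x : x \in unit_pred -> exists y, y * x = 1.
Proof. exact: asboolW. Qed.

Let inv x : padic_int :=
  if pselect (exists y, y * x = 1) is left ex then projT1 (cid ex) else x.

Let mulVx : {in unit_pred, left_inverse 1 inv *%R}.
Proof.
move=> x /unit_sig ex; rewrite /inv; case: pselect => // ex'.
exact: (projT2 (cid ex')).
Qed.
Let unitPl x y : y * x = 1 -> x \in unit_pred.
Proof. by move=> yx; apply/asboolP; exists y. Qed.
Let inv_out : {in [predC unit_pred], inv =1 id}.
Proof.
move=> x /negP nux; rewrite /inv; case: pselect => // ex.
by case: nux; apply/asboolP.
Qed.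

HB.instance Definition _ :=
  GRing.ComNzRing_hasMulInverse.Build padic_int mulVx unitPl inv_out.

Lemma padic_neq0P x :
  reflect (exists i, ~~ (p ^ i.+1 %| (x i : nat))%N) (x != 0).
Proof.
apply: (iffP idP) => [x_neq0 | [i]]; last first.
  by apply: contraNneq => ->; apply: dvdn0.
apply: contrapT => all0; case/eqP: x_neq0; apply: val_inj.
apply: functional_extensionality_dep => i /=.
have /dvdnP[m def_x] : (p ^ i.+1 %| (x i : nat))%N.
  by apply/negPn/negP => ?; apply: all0; exists i.
rewrite -[LHS]natr_Zp def_x -[RHS]/(0%:R); apply/Zp_natP => //.
by rewrite modnMl mod0n.
Qed.

Lemma padic_mulf_eq0 x y : x * y = 0 -> (x == 0) || (y == 0).
Proof.
move=> xy0; apply/negPn; rewrite negb_or; apply/negP => /andP[].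
case/padic_neq0P=> i xi /padic_neq0P[j yj].
have p_pr := prime_valP p; have p_gt0 := prime_gt0 p_pr.
have aux (z : padic_int) l : (l <= (i + j).+1)%N ->
    ~~ (p ^ l.+1 %| (z l : nat))%N ->
    (0 < (z (i + j).+1 : nat))%N && (logn p (z (i + j).+1 : nat) <= l)%N.
  move=> le_l zl; have zl' : ~~ (p ^ l.+1 %| (z (i + j).+1 : nat))%N.
    apply: contra zl => dvd_z; rewrite -(padic_coherent z le_l) /Zp_red.
    by rewrite val_Zp_nat ?expn_prime_gt1 // /dvdn modn_mod.
  have z_gt0 : (0 < (z (i + j).+1 : nat))%N.
    by case: posnP zl' => // ->; rewrite dvdn0.
  by rewrite z_gt0 /= leqNgt; apply: contra zl'; rewrite pfactor_dvdn.
have /andP[x_gt0 lx] := aux x i (leqW (leq_addr j i)) xi.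
have /andP[y_gt0 ly] := aux y j (leqW (leq_addl i j)) yj.
have /(congr1 (fun z : padic_int => z (i + j).+1)) := xy0.
rewrite -[LHS]/(x (i + j).+1 * y (i + j).+1) -[RHS]/(0%:R).
rewrite -[X in X * _]natr_Zp -[X in _ * X]natr_Zp -natrM.
move/(@Zp_natP p (i + j).+2 _ 0 isT); rewrite mod0n -/(dvdn _ _).
rewrite pfactor_dvdn ?muln_gt0 ?x_gt0 // lognM //.
by rewrite leqNgt ltnS (leq_trans (leq_add lx ly)) ?leqnSn.
Qed.

HB.instance Definition _ :=
  GRing.ComUnitRing_isIntegral.Build padic_int padic_mulf_eq0.

Definition padic_mod n x : 'Z_(p ^ n) := Zp_red n (x n.-1).

Lemma padic_modE i x : padic_mod i.+1 x = x i.
Proof. exact: Zp_red_id. Qed.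

End PadicIntegers.

Notation "''Zp_[' p ]" := (padic_int p) (format "''Zp_[' p ]").
Notation "''Qp_[' p ]" := {fraction padic_int p} (format "''Qp_[' p ]").

(* Reduction modulo p^n of a p-adic number; junk value 0 outside Z_p. *)
Definition Qp_mod (p : primeNum) n (x : 'Qp_[p]) : 'Z_(p ^ n) :=
  if pselect (exists a : 'Zp_[p], x = tofrac a) is left ex
  then padic_mod n (projT1 (cid ex)) else 0.

Lemma Qp_mod_tofrac (p : primeNum) n (a : 'Zp_[p]) :
  Qp_mod n (tofrac a) = padic_mod n a.
Proof.
rewrite /Qp_mod; case: pselect => [ex | []]; last by exists a.
by have /eqP := projT2 (cid ex); rewrite tofrac_eq => /eqP <-.
Qed.

(* The quotient of the product of the Z/p^n by their direct sum.  Only n >= 1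
   is meaningful, as 'Z_(p ^ 0) is Z/2. *)
Section PrimeQuotient.
Variable n : nat.

Definition primeProd := dprod (fun p : primeNum => 'Z_(p ^ n)).
HB.instance Definition _ := GRing.ComNzRing.on primeProd.

Definition primeSum : {pred primeProd} :=
  [pred x | `[< finite_set [set p | x p != 0] >]].

Lemma finite_primesP (P : set primeNum) :
  finite_set P <-> exists N, forall p : primeNum, (N < p)%N -> ~ P p.
Proof.
split=> [/finite_seqP[s ->] | [N PN]].
  exists (\max_(q <- s) (q : nat))%N => p lt_p /= ps.
  by move: lt_p; rewrite ltnNge => /negP; apply; apply: leq_bigmax_seq.
apply: (@sub_finite_set _ _ [set` pmap (insub : nat -> option primeNum) (iota 0 N.+1)]);
  last by apply/finite_seqP; eexists.
move=> p Pp; suff: p \in pmap insub (iota 0 N.+1) by [].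
by rewrite mem_pmap_sub mem_iota /= add0n ltnS leqNgt; apply/negP => /PN.
Qed.

Lemma primeSumP (x : primeProd) :
  reflect (exists N, forall p : primeNum, (N < p)%N -> x p = 0) (x \in primeSum).
Proof.
apply: (iffP (asboolP _)) => [/finite_primesP[N xN] | [N xN]].
  by exists N => p /xN /negP; rewrite negbK => /eqP.
by apply/finite_primesP; exists N => p /xN /= ->; rewrite eqxx.
Qed.

Lemma primeSum_ideal : idealr_closed primeSum.
Proof.
split.
- by apply/primeSumP; exists 0%N.
- apply/primeSumP => -[N N1]; have [q ltNq q_pr] := prime_above N.
  have /eqP := N1 (PrimeNum q_pr) ltNq.
  by rewrite -[X in X == _]/(1 : 'Z_(q ^ n)) oner_eq0.
- move=> a x y /primeSumP[N xN] /primeSumP[M yM]; apply/primeSumP.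
  exists (maxn N M) => p; rewrite gtn_max => /andP[/xN x0 /yM y0].
  by rewrite dprodDE dprodME x0 y0 mulr0 addr0.
Qed.

HB.instance Definition _ := isIdealr.Build primeProd primeSum primeSum_ideal.

Definition calA := {ideal_quot primeSum}.
HB.instance Definition _ := GRing.ComNzRing.on calA.

Definition calA_of (x : forall p : primeNum, 'Z_(p ^ n)) : calA :=
  \pi_{ideal_quot primeSum} (x : primeProd).

Lemma calA_ofP (x y : forall p : primeNum, 'Z_(p ^ n)) :
  calA_of x = calA_of y <->
  exists N, forall p : primeNum, (N < p)%N -> x p = y p.
Proof.
rewrite /calA_of; split=> [/eqP | [N xy]].
  rewrite piE Quotient.equivE => /primeSumP[N xyN]; exists N => p /xyN /eqP.
  by rewrite dprodDE dprodNE subr_eq0 => /eqP.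
apply/eqP; rewrite piE Quotient.equivE; apply/primeSumP; exists N => p /xy xyp.
by rewrite dprodDE dprodNE xyp subrr.
Qed.

Lemma calA_ofD (x y : forall p : primeNum, 'Z_(p ^ n)) :
  calA_of x + calA_of y = calA_of (fun p => x p + y p).
Proof.
exact: (esym (rmorphD \pi_{ideal_quot primeSum} (x : primeProd) (y : primeProd))).
Qed.

Lemma calA_ofN (x : forall p : primeNum, 'Z_(p ^ n)) :
  - calA_of x = calA_of (fun p => - x p).
Proof.
exact: (esym (rmorphN \pi_{ideal_quot primeSum} (x : primeProd))).
Qed.

Lemma calA_ofM (x y : forall p : primeNum, 'Z_(p ^ n)) :
  calA_of x * calA_of y = calA_of (fun p => x p * y p).
Proof.
exact: (esym (rmorphM \pi_{ideal_quot primeSum} (x : primeProd) (y : primeProd))).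
Qed.

Lemma calA_of1 : 1 = calA_of (fun p => 1).
Proof. exact: (esym (rmorph1 \pi_{ideal_quot primeSum})). Qed.

Lemma calA_of_nat m : m%:R = calA_of (fun p => m%:R).
Proof.
elim: m => [|m IHm].
  exact: (esym (rmorph0 \pi_{ideal_quot primeSum})).
rewrite mulrS IHm calA_of1 calA_ofD; congr calA_of.
by apply: functional_extensionality_dep => p; rewrite mulrS.
Qed.

End PrimeQuotient.

(* A formal power series is its sequence of coefficients. *)
Section PowerSeries.
Variable K : fieldType.
Implicit Types f g : nat -> K.

Definition ps_mul f g : nat -> K := fun n => \sum_(i < n.+1) f i * g (n - i)%N.

Fixpoint ps_div_seq f g n : seq K :=
  if n is m.+1 then
    let s := ps_div_seq f g m in
    rcons s ((f m - \sum_(i < m) s`_i * g (m - i)%N) / g 0%N)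
  else [::].

Definition ps_div f g : nat -> K := fun n => (ps_div_seq f g n.+1)`_n.

Lemma size_ps_div_seq f g n : size (ps_div_seq f g n) = n.
Proof. by elim: n => //= n IHn; rewrite size_rcons IHn. Qed.

Lemma nth_ps_div_seq f g n i : (i < n)%N -> (ps_div_seq f g n)`_i = ps_div f g i.
Proof.
elim: n => // n IHn; rewrite ltnS leq_eqVlt => /predU1P[-> // | lt_in].
by rewrite /= nth_rcons size_ps_div_seq lt_in IHn.
Qed.

Lemma ps_divE f g n :
  ps_div f g n = (f n - \sum_(i < n) ps_div f g i * g (n - i)%N) / g 0%N.
Proof.
rewrite {1}/ps_div /= nth_rcons size_ps_div_seq ltnn eqxx.
by congr ((_ - _) / _); apply: eq_bigr => i _; rewrite nth_ps_div_seq.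
Qed.

Lemma ps_divK f g : g 0%N != 0 -> ps_mul (ps_div f g) g =1 f.
Proof.
move=> g0 n; rewrite /ps_mul big_ord_recr /= subnn [ps_div f g n]ps_divE.
by rewrite divfK // addrC subrK.
Qed.

Definition ps_exp (a : K) : nat -> K := fun n => a ^+ n / n`!%:R.

(* (exp (a t) - 1) / t *)
Definition ps_expm1_div (a : K) : nat -> K := fun n => ps_exp a n.+1.

End PowerSeries.

(* B_m / m! is the coefficient of t^m in e^t / ((e^t - 1) / t). *)
Definition bernoulli (m : nat) : rat :=
  m`!%:R * ps_div (ps_exp 1) (ps_expm1_div 1) m.

Lemma bernoulli_gf :
  ps_mul (fun m => bernoulli m / m`!%:R) (ps_expm1_div 1) =1 ps_exp 1.
Proof.
move=> n; rewrite -[RHS](@ps_divK _ _ (ps_expm1_div 1)) //.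
apply: eq_bigr => i _; congr (_ * _); rewrite /bernoulli mulrAC mulfV ?mul1r //.
by rewrite pnatr_eq0 -lt0n fact_gt0.
Qed.

Definition bernoulli_hat (m : nat) : rat := bernoulli m / m%:R.

(* A Dirichlet character modulo N, extended by 0 to all natural numbers. *)
Record dirichlet (K : fieldType) (N : nat) := Dirichlet {
  dchar :> nat -> K;
  dchar_mod : forall a, dchar (a %% N) = dchar a;
  dchar1 : dchar 1 = 1;
  dcharM : {morph dchar : a b / (a * b)%N >-> a * b};
  dchar_eq0 : forall a, (dchar a == 0) = ~~ coprime a N }.

Section DirichletPower.
Variables (K : fieldType) (N : nat) (chi : dirichlet K N) (k : nat).

Definition dchar_expN_fun (a : nat) : K :=
  if coprime a N then chi a ^- k else 0.

Let expN_mod a : dchar_expN_fun (a %% N) = dchar_expN_fun a.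
Proof. by rewrite /dchar_expN_fun coprime_modl dchar_mod. Qed.
Let expN1 : dchar_expN_fun 1 = 1.
Proof. by rewrite /dchar_expN_fun coprime1n dchar1 expr1n invr1. Qed.
Let expNM : {morph dchar_expN_fun : a b / (a * b)%N >-> a * b}.
Proof.
move=> a b; rewrite /dchar_expN_fun coprimeMl dcharM exprMn invfM.
by case: coprime; case: coprime; rewrite /= ?mulr0 ?mul0r.
Qed.
Let expN_eq0 a : (dchar_expN_fun a == 0) = ~~ coprime a N.
Proof.
rewrite /dchar_expN_fun; case: ifPn => [cop | _]; last by rewrite eqxx.
by rewrite invr_eq0 expf_eq0 dchar_eq0 cop andbF.
Qed.

(* The Dirichlet character chi^(-k) modulo N. *)
Definition dchar_expN : dirichlet K N :=
  Dirichlet expN_mod expN1 expNM expN_eq0.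

End DirichletPower.

(* B_{m,chi} / m! is the coefficient of t^m in
   sum_(1 <= a <= N) chi(a) e^(a t) / ((e^(N t) - 1) / t), for K of
   characteristic 0. *)
Definition gen_bernoulli (K : fieldType) (N : nat) (chi : dirichlet K N)
    (m : nat) : K :=
  m`!%:R *
  \sum_(1 <= a < N.+1) chi a * ps_div (ps_exp a%:R) (ps_expm1_div N%:R) m.

Lemma gen_bernoulli1E (K : fieldType) (N : nat) (chi : dirichlet K N) :
    [pchar K] =i pred0 -> (0 < N)%N -> \sum_(1 <= a < N.+1) chi a = 0 ->
  gen_bernoulli chi 1 = N%:R^-1 * \sum_(1 <= a < N.+1) chi a * a%:R.
Proof.
move=> K0 N_gt0 sum0; have N0 : N%:R != 0 :> K.
  by have/pcharf0P -> := K0; rewrite -lt0n.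
have D1 (a : nat) : ps_div (ps_exp a%:R) (ps_expm1_div N%:R) 1%N =
    N%:R^-1 * a%:R - ps_expm1_div N%:R 1%N / N%:R ^+ 2 :> K.
  rewrite ps_divE big_ord1 subn0 [ps_div _ _ _]ps_divE big_ord0 subr0.
  rewrite /ps_expm1_div /ps_exp !fact0 !factS fact0 !muln1 !expr1 !expr0 !divr1.
  move: (2%:R^-1) => h; by field.
rewrite /gen_bernoulli mul1r.
under eq_bigr do rewrite D1 mulrBr mulrCA.
by rewrite sumrB -mulr_suml sum0 mul0r subr0 -mulr_sumr.
Qed.

Section Teichmuller.
Variable p : primeNum.
Let p_pr : prime p := prime_valP p.

(* omega(a) is the p-adic limit of the a^(p^i), and a^(p^i) is already its
   residue modulo p^(i+1). *)
Definition teich_seq (a : nat) : padic_prod p := fun i => a%:R ^+ (p ^ i).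

Lemma expn_prime_tower a i :
  (a ^ (p ^ i.+1) = a ^ (p ^ i) %[mod p ^ i.+1])%N.
Proof.
have [p_dvd | cop] := boolP (p %| a)%N.
  have dvd j : (i <= j)%N -> (p ^ i.+1 %| a ^ (p ^ j))%N.
    move=> le_ij; apply: dvdn_trans (dvdn_exp2l p _) (dvdn_exp2r _ p_dvd).
    by apply: leq_ltn_trans le_ij _; apply/ltn_expl/prime_gt1.
  by rewrite (eqP (dvd _ (leqnSn i))) (eqP (dvd _ (leqnn i))).
rewrite -prime_coprime // coprime_sym in cop.
have {1}-> : (p ^ i.+1 = totient (p ^ i.+1) + p ^ i)%N.
  by rewrite totient_pfactor //= expnS addnC -mulSn prednK ?prime_gt0.
rewrite expnD -modnMml Euler_exp_totient ?modnMml ?mul1n //.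
by rewrite coprime_pexpr.
Qed.

Lemma teich_coherent a : teich_seq a \in @coherent p.
Proof.
apply/coherentP => i; rewrite /teich_seq -!natrX Zp_red_nat ?leqnSn //.
by apply/Zp_natP => //; apply/eqP/expn_prime_tower.
Qed.

Definition teich (a : nat) : 'Zp_[p] := PadicInt (teich_coherent a).

Lemma teichM : {morph teich : a b / (a * b)%N >-> a * b}.
Proof.
move=> a b; apply: val_inj; apply: functional_extensionality_dep => i.
by rewrite /= /teich_seq natrM exprMn.
Qed.

Lemma teich1 : teich 1 = 1.
Proof.
apply: val_inj; apply: functional_extensionality_dep => i.
by rewrite /= /teich_seq expr1n.
Qed.

Lemma teich_mod a : padic_mod 1 (teich a) = a%:R.
Proof. by rewrite padic_modE. Qed.

Lemma teich_unity a : coprime a p -> teich a ^+ p.-1 = 1.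
Proof.
move=> cop; have expE m b : teich b ^+ m = teich (b ^ m)%N.
  by elim: m => [|m IHm]; rewrite ?teich1 // exprS expnS teichM IHm.
rewrite expE; apply: val_inj; apply: functional_extensionality_dep => i.
rewrite /= /teich_seq -natrX -[RHS]/(1%:R); apply/Zp_natP => //; apply/eqP.
rewrite -expnM (_ : (p.-1 * p ^ i = totient (p ^ i.+1))%N); last first.
  by rewrite totient_pfactor.
by rewrite Euler_exp_totient // coprime_pexpr.
Qed.

Lemma dvdn_sub_exp m n j : (n <= m)%N -> (0 < j)%N ->
  (p ^ j %| m - n)%N -> (p ^ j.+1 %| m ^ p - n ^ p)%N.
Proof.
move=> le_nm j_gt0 dvd_mn; rewrite subn_exp expnSr dvdn_mul //.
have eq_mn : (m = n %[mod p])%N.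
  apply/eqP; rewrite eqn_mod_dvd //; apply: dvdn_trans dvd_mn.
  by rewrite -{1}(expn1 p) dvdn_exp2l.
rewrite /dvdn -modn_summ.
under eq_bigr => i _.
  rewrite -modnMml -modnXm eq_mn modnXm modnMml -expnD subnK; last first.
    by rewrite -ltnS prednK ?prime_gt0.
  over.
by rewrite modn_summ sum_nat_const card_ord modnMr.
Qed.

Lemma teich_periodic a : teich (a %% p) = teich a.
Proof.
apply: val_inj; apply: functional_extensionality_dep => i /=.
rewrite /teich_seq -!natrX; apply/Zp_natP => //.
rewrite eq_sym eqn_mod_dvd ?leq_exp2r ?expn_gt0 ?prime_gt0 ?leq_mod //.
elim: i => [|i IHi]; first by rewrite -eqn_mod_dvd ?leq_mod // modn_mod.
rewrite [X in (a ^ X - _ ^ X)%N]expnSr !expnM dvdn_sub_exp // leq_exp2r ?leq_mod //.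
by rewrite expn_gt0 prime_gt0.
Qed.

Let omega_eq0 a : (tofrac (teich a) == 0) = ~~ coprime a p.
Proof.
rewrite tofrac_eq0; have [cop | ncop] := boolP (coprime a p).
  apply: contraTF (oner_neq0 'Zp_[p]) => /eqP t0; rewrite negbK.
  rewrite -(teich_unity cop) t0 expr0n -subn1 subn_eq0 leqNgt.
  by rewrite prime_gt1 //=.
rewrite -teich_periodic; rewrite coprime_sym prime_coprime // negbK in ncop.
rewrite (eqP ncop); apply/eqP/val_inj; apply: functional_extensionality_dep.
by move=> i; rewrite /= /teich_seq expr0n expn_eq0 eqn0Ngt prime_gt0.
Qed.

Let omega1 : tofrac (teich 1) = 1 :> 'Qp_[p].
Proof. by rewrite teich1 tofrac1. Qed.
Let omegaM : {morph (fun a => tofrac (teich a)) : a b / (a * b)%N >-> a * b}.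
Proof. by move=> a b; rewrite teichM tofracM. Qed.
Let omega_mod a : tofrac (teich (a %% p)) = tofrac (teich a).
Proof. by rewrite teich_periodic. Qed.

Definition teich_char : dirichlet 'Qp_[p] p :=
  Dirichlet omega_mod omega1 omegaM omega_eq0.

End Teichmuller.

(* Main.v *)
From HB Require Import structures.
Require Import Defs.
From mathcomp Require Import all_boot all_order all_algebra.
From mathcomp Require boolp.
From mathcomp Require Import cyclic finfield ring zify.

(** Fix a modulus N = p^e, with e = 1 or 2, and a multiplier c prime to p, and
    for a function F on the naturals put
    [carry_sum N c F] = sum over a < N of F(a) * floor(c a / N).
    Both sides of the congruences are values of this one linear functional,
    divided by one and the same p-adic unit.

    - Multiplication by c permutes the residues modulo N, and the residue of
      c a is c a - N floor(c a / N).  Taking n-th powers, expanding modulo N^2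
      and summing over a gives ([voronoi_identity])
      (c^n - 1) S = n N c^(n-1) carry_sum(a^(n-1)) modulo N^2,
      where S is the sum of the a^n for a < N.  Faulhaber's formula, with enough
      control of the denominators of Bernoulli numbers, gives
      S = N B_n modulo N^2 when p - 1 divides neither n nor n - 1
      ([powersum_mod_sqr]).  Hence, for n prime to p, Voronoi's congruence
      ([bernoulli_hat_voronoi])
      (c^n - 1) B_n / n = c^(n-1) carry_sum(a^(n-1)) modulo N.

    - For a nontrivial character chi modulo p, the same permutation argument
      applied to the sum of chi(a) a gives the exact p-adic identity
      (c chi(c) - 1) B_(1,chi) = chi(c) carry_sum(chi)
      ([char_voronoi], [teich_B1_voronoi]).

    Let chi be the (-k)-th power of the Teichmuller character.  Choose c of
    multiplicative order p - 1 modulo N and generating the units modulo p.  Then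
    chi(c) = c^(-k), which is c^(n-1) both for n = p - k and for
    n = 2p - k - 1, so the factors in front are the same, and
    c^(1-k) - 1 is a unit because p - 1 does not divide k - 1
    ([common_voronoi]).

    It remains to compare chi(a) with powers of a, for a prime to p.  Modulo p,
    chi(a) is a^(p-k-1).  Modulo p^2, write a^(p-1) = 1 + t with t^2 = 0; then
    chi(a) = a^(-kp), while a^(p-k-1) and a^(2p-k-2) are chi(a) times
    1 + (k+1) t and 1 + (k+2) t, and
    (k+2) (1 + (k+1) t) - (k+1) (1 + (k+2) t) = 1,
    which is where the coefficients k + 2 and - (k + 1) come from
    ([teich_exponent_mod2]). *)

Set Implicit Arguments.
Unset Strict Implicit.
Unset Printing Implicit Defensive.

Import Order.TTheory GRing.Theory Num.Theory.
Local Open Scope ring_scope.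

(** * Preliminary identities *)

Lemma expr_add_mod_sqr (R : comNzRingType) (x y : R) n :
  exists z, (x + y) ^+ n = x ^+ n + x ^+ n.-1 * y *+ n + y ^+ 2 * z.
Proof.
elim: n => [|n [z IHn]]; first by exists 0; rewrite mulr0n mulr0 !addr0.
exists (x * z + x ^+ n.-1 *+ n + y * z).
have lead : x * (x ^+ n.-1 * y *+ n) = x ^+ n * y *+ n.
  by case: n {IHn} => [|n]; rewrite ?mulr0n ?mulr0 // mulrnAr mulrA -exprS.
rewrite [in LHS]exprS IHn mulrS mulrDl !mulrDr lead [x ^+ n.+1]exprS -!mulrnAl /=.
by move: (x ^+ n.-1 *+ n) (x ^+ n *+ n) (x ^+ n) => u v w; ring.
Qed.

(** Multiplication by a unit permutes the residues modulo N. *)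
Lemma sum_mod_mul (R : nmodType) (N c : nat) (F : nat -> R) :
  coprime c N -> \sum_(a < N) F (c * a %% N)%N = \sum_(a < N) F a.
Proof.
move=> cop; have [-> | N_gt0] := posnP N; first by rewrite !big_ord0.
pose h (a : 'I_N) : 'I_N := Ordinal (ltn_pmod (c * a) N_gt0).
have h_inj : injective h.
  move=> a b /(congr1 val) /= /eqP; wlog le_ab : a b / (a <= b)%N.
    move=> IH; case: (leqP a b) => [/IH // | /ltnW /IH {}IH ].
    by rewrite eq_sym => /IH ->.
  rewrite eq_sym eqn_mod_dvd ?leq_mul2l ?le_ab ?orbT // -mulnBr.
  rewrite Gauss_dvdr 1?coprime_sym // -eqn_mod_dvd // !modn_small //.
  by move/eqP => eq_ab; apply: val_inj.
by rewrite [RHS](reindex_inj h_inj).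
Qed.

(** * p-integral rationals and their residues *)

Definition pintegral (p : nat) (x : rat) : Prop := coprime p `|denq x|%N.

Lemma pintegralP p x : pintegral p x <->
  exists d : nat, exists m : int, coprime p d /\ x * d%:R = m%:~R.
Proof.
split=> [px | [d [m [cop eq_x]]]].
  exists `|denq x|%N, (numq x); split=> //.
  by rewrite numqE -[in RHS](absz_denq x) -pmulrn.
rewrite /pintegral; apply: coprime_dvdr cop.
have d1: (numq x * d%:Z = m * denq x).
  apply: (@intr_inj rat); rewrite !intrM numqE -eq_x.
  by rewrite -pmulrn; ring.
have : (`|denq x| %| `|numq x| * d)%N.
  by rewrite -[d]absz_nat -abszM d1 abszM dvdn_mull.
by rewrite Gauss_dvdr // coprime_sym coprime_num_den.
Qed.

Lemma pintegral_int p (m : int) : pintegral p m%:~R.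
Proof. by rewrite /pintegral denq_int coprimen1. Qed.

Lemma pintegral_nat p (m : nat) : pintegral p m%:R.
Proof. by rewrite pmulrn; apply: pintegral_int. Qed.

Lemma pintegralD p x y : pintegral p x -> pintegral p y -> pintegral p (x + y).
Proof.
move=> /pintegralP[d [m [cd Ed]]] /pintegralP[f [n [cf Ef]]]; apply/pintegralP.
exists (d * f)%N, (m * f + n * d); rewrite coprimeMr cd cf; split=> //.
by rewrite natrM intrD !intrM -Ed -Ef -!pmulrn; ring.
Qed.

Lemma pintegralM p x y : pintegral p x -> pintegral p y -> pintegral p (x * y).
Proof.
move=> /pintegralP[d [m [cd Ed]]] /pintegralP[f [n [cf Ef]]]; apply/pintegralP.
exists (d * f)%N, (m * n); rewrite coprimeMr cd cf; split=> //.
by rewrite natrM intrM -Ed -Ef; ring.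
Qed.

Lemma pintegralB p x y : pintegral p x -> pintegral p y -> pintegral p (x - y).
Proof.
move=> px py; apply: pintegralD => //; rewrite -mulN1r; apply: pintegralM => //.
exact: (pintegral_int p (-1)).
Qed.

Lemma pintegralX p x n : pintegral p x -> pintegral p (x ^+ n).
Proof.
move=> px; elim: n => [|n IHn]; first exact: (pintegral_nat p 1).
by rewrite exprS; apply: pintegralM.
Qed.

Lemma pintegral_sum p (I : Type) (r : seq I) (P : pred I) (F : I -> rat) :
  (forall i, P i -> pintegral p (F i)) -> pintegral p (\sum_(i <- r | P i) F i).
Proof.
move=> pF; apply: big_ind => //; [exact: (pintegral_nat p 0) | exact: pintegralD].
Qed.

Lemma pintegralV p d : coprime p d -> pintegral p d%:R^-1.
Proof.
move=> cop; apply/pintegralP; have [d0 | d_gt0] := posnP d.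
  by exists 1%N, 0; rewrite coprimen1 d0 invr0 mul0r.
by exists d, 1; rewrite mulVf // pnatr_eq0 -lt0n.
Qed.

(** The size of m bounds the power of p that divides it. *)
Lemma pintegral_div_exp p j m : prime p -> (m < p ^ j.+1)%N ->
  pintegral p (p%:R ^+ j / m%:R).
Proof.
move=> p_pr lt_m; have [-> | m_gt0] := posnP m.
  by rewrite invr0 mulr0; apply: (pintegral_nat p 0).
have [d cop def_m] := pfactor_coprime p_pr m_gt0.
have le_j : (logn p m <= j)%N.
  rewrite -ltnS -(ltn_exp2l _ _ (prime_gt1 p_pr)); apply: leq_ltn_trans lt_m.
  exact: dvdn_leq (pfactor_dvdnn p m).
rewrite def_m natrM natrX -{1}(subnK le_j) exprD invfM mulrCA mulfK.
  by apply: pintegralM; [apply: pintegralV | rewrite -natrX; apply: pintegral_nat].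
by rewrite -natrX pnatr_eq0 expn_eq0 eqn0Ngt prime_gt0.
Qed.

(** Transfers a congruence between rationals to Z/p^e.  On the latter [ratr] is
    only a quotient of residues, so p-integrality of x is what makes the
    denominators cancel. *)
Lemma ratr_mod_eq (p : primeNum) e (A W : int) (x z : rat) : (0 < e)%N ->
  pintegral p x -> pintegral p z -> A%:~R * x - W%:~R = p%:R ^+ e * z ->
  A%:~R * ratr x = W%:~R :> 'Z_(p ^ e).
Proof.
move=> e_gt0 px pz eq_x.
have unit_den y : pintegral p y -> ((denq y)%:~R : 'Z_(p ^ e)) \is a GRing.unit.
  rewrite /pintegral -{2}(absz_denq y) -pmulrn => cop.
  by rewrite unitZpE ?expn_prime_gt1 // coprime_pexpl.
have ux := unit_den _ px; have uz := unit_den _ pz.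
have int_eq : A * numq x * denq z =
    W * denq x * denq z + (p ^ e)%:Z * (numq z * denq x).
  apply: (@intr_inj rat); rewrite !(intrD, intrM) !numqE.
  have -> : A%:~R * (x * (denq x)%:~R) * (denq z)%:~R =
      (A%:~R * x - W%:~R + W%:~R) * (denq x)%:~R * (denq z)%:~R by ring.
  by rewrite eq_x -!pmulrn natrX; ring.
apply: (mulIr ux); apply: (mulIr uz).
rewrite /ratr mulrA divrK //.
rewrite -!intrM int_eq intrD [X in _ + X]intrM -pmulrn.
have -> : (p ^ e)%:R = 0 :> 'Z_(p ^ e).
  by apply/(Zp_natP p (p ^ e) 0 e_gt0); rewrite modnn mod0n.
by rewrite mul0r addr0.
Qed.

(** * Faulhaber's formula *)

Section PowerSeriesProduct.
Variable K : fieldType.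
Implicit Types f g h : nat -> K.

(** Truncation to polynomials transports associativity and commutativity of
    the product of polynomials to power series. *)
Definition ps_trunc n f : {poly K} := \poly_(i < n.+1) f i.

Lemma coef_ps_trunc n f i : (i <= n)%N -> (ps_trunc n f)`_i = f i.
Proof. by move=> le_in; rewrite coef_poly ltnS le_in. Qed.

Lemma coef_ps_truncM n f g i : (i <= n)%N ->
  (ps_trunc n f * ps_trunc n g)`_i = ps_mul f g i.
Proof.
move=> le_in; rewrite coefM; apply: eq_bigr => -[j /= lt_j] _.
by rewrite !coef_ps_trunc //; lia.
Qed.

Lemma ps_mulC f g : ps_mul f g =1 ps_mul g f.
Proof. by move=> n; rewrite -!(coef_ps_truncM _ _ (leqnn n)) mulrC. Qed.

Lemma ps_mulA f g h : ps_mul f (ps_mul g h) =1 ps_mul (ps_mul f g) h.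
Proof.
move=> n; pose P := ps_trunc n.
transitivity (P f * (P g * P h))`_n.
  rewrite coefM; apply: eq_bigr => -[j /= lt_j] _.
  by rewrite coef_ps_trunc ?coef_ps_truncM //; lia.
rewrite mulrA coefM; apply: eq_bigr => -[j /= lt_j] _.
by rewrite coef_ps_trunc ?coef_ps_truncM //; lia.
Qed.

Lemma eq_ps_mul f f' g g' : f =1 f' -> g =1 g' -> ps_mul f g =1 ps_mul f' g'.
Proof. by move=> ff gg n; apply: eq_bigr => i _; rewrite ff gg. Qed.

Lemma ps_mulI f f' g : g 0%N != 0 -> ps_mul f g =1 ps_mul f' g -> f =1 f'.
Proof.
move=> g0 eq_fg n; elim/ltn_ind: n => n IHn.
have := eq_fg n; rewrite /ps_mul !big_ord_recr /= subnn.
under eq_bigr => i _ do rewrite IHn ?ltn_ord //.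
by move/addrI/(mulIf g0).
Qed.

End PowerSeriesProduct.

Lemma fact_rat_neq0 n : n`!%:R != 0 :> rat.
Proof. by rewrite pnatr_eq0 -lt0n fact_gt0. Qed.

Lemma bin_fact_rat n i : (i <= n)%N ->
  'C(n, i)%:R / n`!%:R = (i`!%:R)^-1 * ((n - i)`!%:R)^-1 :> rat.
Proof.
move=> le_in; rewrite -(bin_fact le_in) !natrM.
by rewrite !invfM mulVKf // pnatr_eq0 -lt0n bin_gt0.
Qed.

Lemma ps_exp_mul_expm1 (x y : rat) n :
  ps_mul (ps_exp x) (ps_expm1_div y) n =
  ((x + y) ^+ n.+1 - x ^+ n.+1) / n.+1`!%:R.
Proof.
rewrite [x + y]addrC exprDn big_ord_recr /= subnn expr0 mul1r binn mulr1n addrK.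
rewrite mulr_suml; apply: eq_bigr => -[i /= lt_i] _; rewrite /ps_expm1_div /ps_exp.
rewrite -[_ *+ 'C(_, _)]mulr_natr -[RHS]mulrA bin_fact_rat ?subSn; [ring | lia | lia].
Qed.

(** With G the generating series of the Bernoulli numbers, G (e^t - 1) / t is
    e^t, and both sides multiplied by (e^t - 1) / t are
    (e^((N+1) t) - e^t) / t. *)
Lemma sum_ps_exp N :
  (fun n => \sum_(1 <= a < N.+1) ps_exp (a%:R : rat) n) =1
  ps_mul (fun m => bernoulli m / m`!%:R) (ps_expm1_div N%:R).
Proof.
apply: (@ps_mulI _ _ _ (ps_expm1_div 1)) => // n.
have -> : ps_mul (ps_mul (fun m => bernoulli m / m`!%:R) (ps_expm1_div N%:R))
    (ps_expm1_div 1) n = ps_mul (ps_exp 1) (ps_expm1_div N%:R) n :> rat.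
  rewrite -ps_mulA (eq_ps_mul (frefl _) (ps_mulC _ _)) ps_mulA.
  by apply: eq_ps_mul => //; apply: bernoulli_gf.
have -> : ps_mul (fun n0 => \sum_(1 <= a < N.+1) ps_exp a%:R n0)
    (ps_expm1_div 1) n =
    \sum_(1 <= a < N.+1) ps_mul (ps_exp a%:R) (ps_expm1_div 1) n :> rat.
  by rewrite /ps_mul exchange_big; apply: eq_bigr => i _; rewrite mulr_suml.
under eq_bigr do rewrite ps_exp_mul_expm1 natr1.
rewrite -mulr_suml ps_exp_mul_expm1; congr (_ / _).
by rewrite (telescope_sumr (fun a => a%:R ^+ n.+1)) // nat1r.
Qed.

(** The sum starts at a = 1 because here B_1 = 1/2. *)
Lemma faulhaber N n :
  \sum_(1 <= a < N.+1) a%:R ^+ n =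
  \sum_(i < n.+1) 'C(n, i)%:R * bernoulli i *
                  (N%:R ^+ (n - i).+1 / (n - i).+1%:R) :> rat.
Proof.
have := sum_ps_exp N n; rewrite -mulr_suml => /(canRL (divfK (fact_rat_neq0 n))) ->.
rewrite mulr_suml; apply: eq_bigr => -[i /=]; rewrite ltnS => le_in _.
have := bin_fact_rat le_in => /(canRL (divfK (fact_rat_neq0 n))) ->.
rewrite /ps_expm1_div /ps_exp factS natrM invfM; ring.
Qed.

(** * Denominators of Bernoulli numbers *)

Section BernoulliDenominators.
Variable p : nat.
Hypotheses (p_pr : prime p) (p_gt3 : (3 < p)%N).

Lemma pintegral_powersum N n : pintegral p (\sum_(1 <= a < N.+1) a%:R ^+ n).
Proof. by apply: pintegral_sum => a _; rewrite -natrX; apply: pintegral_nat. Qed.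

(** In Faulhaber's formula the term in B_(n-j) carries p^(j+1) / (j+1).
    Dividing out p^2 for j >= 1, respectively p^3 for j >= 2, leaves these
    p-integral factors. *)
Lemma pintegral_tail1 j : pintegral p (p%:R ^+ j / j.+2%:R).
Proof.
apply: pintegral_div_exp => //; apply: leq_trans (_ : 3 ^ j.+1 <= _)%N.
  by elim: j => // j IHj; rewrite expnS; lia.
by rewrite leq_exp2r // ltnW.
Qed.

Lemma pintegral_tail2 j : pintegral p (p%:R ^+ j / j.+3%:R).
Proof.
apply: pintegral_div_exp => //; apply: leq_trans (_ : 4 ^ j.+1 <= _)%N.
  by elim: j => // j IHj; rewrite expnS; lia.
by rewrite leq_exp2r.
Qed.

(** A weak form of the von Staudt-Clausen theorem, by induction on n: only the
    last term of Faulhaber's formula for N = p is not known to lie in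
    p Z_(p). *)
Lemma bernoulli_powersum_mod n :
  pintegral p (p%:R * bernoulli n) /\ exists2 z, pintegral p z &
    p%:R * bernoulli n = \sum_(1 <= a < p.+1) a%:R ^+ n - p%:R * z.
Proof.
elim/ltn_ind: n => n IHn.
suff [z pz def_B] : exists2 z, pintegral p z &
    p%:R * bernoulli n = \sum_(1 <= a < p.+1) a%:R ^+ n - p%:R * z.
  split; last by exists z.
  rewrite def_B; apply: pintegralB; first exact: pintegral_powersum.
  by apply: pintegralM => //; apply: pintegral_nat.
exists (\sum_(i < n) 'C(n, i)%:R * (p%:R * bernoulli i) *
         (p%:R ^+ (n - i).-1 / (n - i).+1%:R)).
  apply: pintegral_sum => -[i /= lt_in] _; apply: pintegralM; last first.
    by rewrite -[X in X.+1]prednK ?subn_gt0 //; apply: pintegral_tail1.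
  by apply: pintegralM; [apply: pintegral_nat | case: (IHn i lt_in)].
rewrite faulhaber big_ord_recr /= subnn binn mul1r expr1 divr1 mulr_sumr.
rewrite [_ * bernoulli n]mulrC -[LHS]add0r -addrA [_ + - _]addrC addrA.
congr (_ + _); apply/esym/eqP; rewrite subr_eq0; apply/eqP.
apply: eq_bigr => -[i /= lt_in] _.
rewrite -{1}[(n - i)%N]prednK ?subn_gt0 // !exprS; ring.
Qed.

End BernoulliDenominators.

(** * Voronoi's congruence *)

Definition carry_sum (R : comNzRingType) (N c : nat) (F : nat -> R) : R :=
  \sum_(a < N) F a * (c * a %/ N)%:R.

(** The residue of c a is c a - N floor(c a / N); expand its n-th power to first
    order in N and sum over the residues a, which c permutes. *)
Lemma voronoi_identity (N c n : nat) : coprime c N ->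
  exists Z : int,
    (c%:R ^+ n - 1) * \sum_(a < N) a%:R ^+ n =
    n%:R * N%:R * c%:R ^+ n.-1 * carry_sum N c (fun a => a%:R ^+ n.-1)
    - N%:R ^+ 2 * Z.
Proof.
move=> cop; pose f (a : nat) : int := (c * a %/ N)%:R.
have /fin_all_exists[z def_z] (a : 'I_N) : exists z : int,
    (c * a %% N)%:R ^+ n =
    (c%:R * a%:R) ^+ n + (c%:R * a%:R) ^+ n.-1 * - (N%:R * f a) *+ n
    + N%:R ^+ 2 * z.
  have [z def_z] := @expr_add_mod_sqr int (c%:R * a%:R) (- (N%:R * f a)) n.
  exists (f a ^+ 2 * z); rewrite mulrA -exprMn -sqrrN -def_z -natrM.
  by rewrite {2}(divn_eq (c * a) N) natrD natrM /f; congr (_ ^+ _); ring.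
exists (\sum_a z a); rewrite mulrBl mul1r.
rewrite -[X in _ - X](@sum_mod_mul _ N c (fun a => a%:R ^+ n)) //.
under [X in _ - X]eq_bigr do rewrite def_z.
rewrite !big_split /= /carry_sum !mulr_sumr !opprD.
have -> : \sum_(a < N) (c%:R * a%:R) ^+ n =
    \sum_(a < N) c%:R ^+ n * a%:R ^+ n :> int.
  by apply: eq_bigr => a _; rewrite exprMn.
rewrite !addrA subrr add0r -sumrN; congr (_ - _).
apply: eq_bigr => a _; rewrite exprMn -mulr_natr /f; ring.
Qed.

Lemma primitive_root_Fp (p : nat) : prime p -> exists2 g : nat,
  coprime g p & forall m, (g%:R ^+ m == 1 :> 'F_p) = (p.-1 %| m)%N.
Proof.
move=> p_pr; have p1_gt0 : (0 < p.-1)%N by have := prime_gt1 p_pr; case: (p) => [|[]].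
have : has p.-1.-primitive_root (enum (predC1 (0 : 'F_p))).
  apply: has_prim_root; rewrite ?enum_uniq //; last first.
    by rewrite -cardE cardC1 card_Fp.
  apply/allP => x; rewrite mem_enum => x_neq0.
  apply/unity_rootP; apply: (mulfI x_neq0); rewrite -exprS mulr1.
  by rewrite prednK ?prime_gt0 //; have := expf_card x; rewrite card_Fp.
case/hasP => x; rewrite mem_enum => x_neq0 prim_x.
exists x => [|m]; last by rewrite natr_Zp (prim_order_dvd prim_x).
by rewrite coprime_sym prime_coprime // (dvdn_pcharf (pchar_Fp p_pr)) natr_Zp.
Qed.

Lemma rmorph_carry_sum (R S : comNzRingType) (f : {rmorphism R -> S}) N c F :
  f (carry_sum N c F) = carry_sum N c (fun a => f (F a)).
Proof. by rewrite rmorph_sum; apply: eq_bigr => a _; rewrite rmorphM rmorph_nat. Qed.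

Lemma powersum_shift (R : pzSemiRingType) N n : (0 < n)%N ->
  \sum_(1 <= a < N.+1) a%:R ^+ n = \sum_(a < N) a%:R ^+ n + N%:R ^+ n :> R.
Proof.
move=> n_gt0; rewrite -(big_mkord xpredT (fun a => a%:R ^+ n)) -big_nat_recr //=.
by rewrite [RHS]big_ltn // expr0n eqn0Ngt n_gt0 add0r.
Qed.

Section Voronoi.
Variable p : nat.
Hypotheses (p_pr : prime p) (p_gt3 : (3 < p)%N).
Let p_neq0 : p%:R != 0 :> rat.
Proof. by rewrite pnatr_eq0 -lt0n prime_gt0. Qed.

(** [voronoi_identity] modulo p, where the multiplier is a primitive root g, so
    that g^n - 1 is invertible. *)
Lemma prime_dvd_powersum n : ~~ (p.-1 %| n)%N ->
  exists q : int, \sum_(a < p) a%:R ^+ n = p%:R * q.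
Proof.
move=> ndvd; have [g cop prim_g] := primitive_root_Fp p_pr.
have [Z /(congr1 (fun x : int => x%:~R : 'F_p))] := voronoi_identity n cop.
set S : int := \sum_(a < p) _.
have p0 : p%:R = 0 :> 'F_p by apply: pcharf0; apply: pchar_Fp.
rewrite !(rmorphM, rmorphB, rmorphXn) /= !rmorph_nat rmorph1 p0.
rewrite mulr0 !mul0r subr0 => /eqP.
rewrite mulf_eq0 subr_eq0 prim_g (negPf ndvd) /= => S0.
suff /dvdzP[q ->] : (p%:Z %| S)%Z by exists q; rewrite mulrC natz.
rewrite dvdzE absz_nat (dvdn_pcharf (pchar_Fp p_pr)).
by case: (S) S0 => m //=; rewrite NegzE mulrNz oppr_eq0.
Qed.

Lemma pintegral_bernoulli n : ~~ (p.-1 %| n)%N -> pintegral p (bernoulli n).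
Proof.
move=> ndvd; have n_gt0 : (0 < n)%N by case: n ndvd; rewrite ?dvdn0.
have [_ [z pz def_B]] := bernoulli_powersum_mod p_pr p_gt3 n.
have [q def_S] := prime_dvd_powersum ndvd.
suff -> : bernoulli n = q%:~R + p%:R ^+ n.-1 - z.
  apply: pintegralB => //; apply: pintegralD; first exact: pintegral_int.
  by apply: pintegralX; apply: pintegral_nat.
apply: (mulfI p_neq0); rewrite def_B powersum_shift //.
have -> : \sum_(a < p) a%:R ^+ n = p%:R * q%:~R :> rat.
  have := congr1 (fun x : int => x%:~R : rat) def_S.
  rewrite rmorphM /= rmorph_sum rmorph_nat => <-.
  by apply: eq_bigr => a _; rewrite rmorphXn /= rmorph_nat.
by rewrite mulrBr mulrDr -exprS prednK.
Qed.

(** The terms of Faulhaber's formula in B_n and B_(n-1) are separated off.  The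
    latter is p-integral as p - 1 does not divide n - 1; the earlier Bernoulli numbers may have
    p in the denominator, which is absorbed by the higher power of N. *)
Lemma powersum_mod_sqr e n : (0 < e)%N ->
    ~~ (p.-1 %| n)%N -> ~~ (p.-1 %| n.-1)%N ->
  exists2 y, pintegral p y &
    \sum_(a < p ^ e) a%:R ^+ n =
      (p ^ e)%:R * bernoulli n + (p ^ e)%:R ^+ 2 * y.
Proof.
case: n => [|[|n]] e_gt0 ndvd ndvd'; rewrite ?dvdn0 // in ndvd ndvd' *.
exists (n.+2%:R * bernoulli n.+1 / 2%:R
  + \sum_(i < n.+1) 'C(n.+2, i)%:R * (p%:R * bernoulli i) *
      ((p ^ e.-1)%:R ^+ (n - i).+1 * (p%:R ^+ (n - i) / (n - i).+3%:R))
  - (p ^ e)%:R ^+ n).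
  apply: pintegralB; last by apply: pintegralX; apply: pintegral_nat.
  apply: pintegralD.
    apply: pintegralM; last by apply: pintegralV; rewrite prime_coprime // gtnNdvd // ltnW.
    by apply: pintegralM; [apply: pintegral_nat | apply: pintegral_bernoulli].
  apply: pintegral_sum => i _; apply: pintegralM; last first.
    by apply: pintegralM; [apply/pintegralX/pintegral_nat | apply: pintegral_tail2].
  apply: pintegralM; first exact: pintegral_nat.
  by have [] := bernoulli_powersum_mod p_pr p_gt3 i.
have := faulhaber (p ^ e) n.+2; rewrite powersum_shift // => /(canRL (addrK _)) ->.
rewrite 2!big_ord_recr /= subnn binn mul1r expr1 divr1 subSnn binSn.
have def_N : (p ^ e)%:R = p%:R * (p ^ e.-1)%:R :> rat.
  by rewrite -natrM -expnS prednK.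
have -> : \sum_(i < n.+1) 'C(n.+2, i)%:R * bernoulli i *
    ((p ^ e)%:R ^+ (n.+2 - i).+1 / (n.+2 - i).+1%:R) =
    (p ^ e)%:R ^+ 2 *
    \sum_(i < n.+1) 'C(n.+2, i)%:R * (p%:R * bernoulli i) *
      ((p ^ e.-1)%:R ^+ (n - i).+1 * (p%:R ^+ (n - i) / (n - i).+3%:R)) :> rat.
  rewrite mulr_sumr; apply: eq_bigr => -[i /= lt_i] _.
  have -> : (n.+2 - i = (n - i).+2)%N by lia.
  rewrite def_N !exprMn !exprS; ring.
rewrite !exprS; ring.
Qed.

End Voronoi.

(** Substitute S = N B_n modulo N^2 in [voronoi_identity] and divide by n N. *)
Lemma bernoulli_hat_voronoi (p : primeNum) (e n c : nat) :
    (3 < p)%N -> (0 < e)%N -> coprime c p ->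
    ~~ (p.-1 %| n)%N -> ~~ (p.-1 %| n.-1)%N -> coprime p n ->
  (c%:R ^+ n - 1) * ratr (bernoulli_hat n) =
  c%:R ^+ n.-1 * carry_sum (p ^ e) c (fun a => a%:R ^+ n.-1) :> 'Z_(p ^ e).
Proof.
move=> p_gt3 e_gt0 cop ndvd ndvd' cop_n; have p_pr := prime_valP p.
have cop_e : coprime c (p ^ e) by rewrite coprimeXr.
have [Z def_Z] := voronoi_identity n cop_e.
have [y py def_S] := powersum_mod_sqr p_pr p_gt3 e_gt0 ndvd ndvd'.
set N := (p ^ e)%N in def_Z def_S *.
have N_neq0 : N%:R != 0 :> rat by rewrite pnatr_eq0 -lt0n expn_gt0 prime_gt0.
have n_neq0 : n%:R != 0 :> rat.
  by rewrite pnatr_eq0; apply: contra ndvd => /eqP ->; apply: dvdn0.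
pose A : int := c%:R ^+ n - 1.
pose W : int := c%:R ^+ n.-1 * carry_sum N c (fun a => a%:R ^+ n.-1).
have AE (R : comNzRingType) : A%:~R = c%:R ^+ n - 1 :> R.
  by rewrite rmorphB rmorphXn /= rmorph_nat.
have WE (R : comNzRingType) :
    W%:~R = c%:R ^+ n.-1 * carry_sum N c (fun a => a%:R ^+ n.-1) :> R.
  rewrite rmorphM rmorphXn /= rmorph_nat (rmorph_carry_sum (intmul 1)).
  congr (_ * _); apply: eq_bigr => a _.
  by rewrite rmorphXn /= rmorph_nat.
rewrite -AE -WE.
apply: (@ratr_mod_eq _ _ _ _ _ (- ((Z%:~R + A%:~R * y) / n%:R))) => //.
- by apply: pintegralM; [apply: pintegral_bernoulli | apply: pintegralV].
- rewrite -mulN1r; apply: pintegralM; first exact: (pintegral_int p (-1)).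
  apply: pintegralM; last exact: pintegralV.
  by apply: pintegralD; first exact: pintegral_int;
     apply: pintegralM => //; apply: pintegral_int.
have {}def_Z : A * \sum_(a < N) a%:R ^+ n = n%:R * N%:R * W - N%:R ^+ 2 * Z.
  by rewrite /W mulrA.
rewrite -natrX -/N; clearbody A W N.
apply: (mulfI n_neq0); apply: (mulfI N_neq0).
have {}def_Z : A%:~R * (N%:R * bernoulli n + N%:R ^+ 2 * y) =
    n%:R * N%:R * W%:~R - N%:R * N%:R * Z%:~R.
  have := congr1 (fun x : int => x%:~R : rat) def_Z.
  rewrite rmorphB !rmorphM /= !rmorph_nat rmorph_sum => <-.
  rewrite -def_S; congr (_ * _).
  by apply: eq_bigr => a _; rewrite rmorphXn /= rmorph_nat.
rewrite /bernoulli_hat.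
have -> : N%:R * (n%:R * (A%:~R * (bernoulli n / n%:R) - W%:~R)) =
    A%:~R * (N%:R * bernoulli n + N%:R ^+ 2 * y)
    - n%:R * N%:R * W%:~R - N%:R ^+ 2 * A%:~R * y.
  by field.
by rewrite def_Z; field.
Qed.

(** * Character sums *)

Section CharacterSums.
Variables (R : comNzRingType) (p : nat) (F : nat -> R).
Hypotheses (F_mod : forall a, F (a %% p)%N = F a)
           (FM : {morph F : a b / (a * b)%N >-> a * b}).

Lemma char_sum_mul c : coprime c p -> F c * \sum_(a < p) F a = \sum_(a < p) F a.
Proof.
move=> cop; rewrite -[RHS](@sum_mod_mul _ p c) // mulr_sumr.
by apply: eq_bigr => a _; rewrite F_mod FM.
Qed.

(** Passing from p to a multiple of p as modulus does not change the normalized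
    first moment of F, because the translates of a period contribute multiples
    of the vanishing sum of F. *)
Lemma char_first_moment q : \sum_(a < p) F a = 0 ->
  \sum_(a < q * p) F a * a%:R = q%:R * \sum_(a < p) F a * a%:R.
Proof.
move=> sum0; rewrite -(big_mkord xpredT (fun a => F a * a%:R)) big_nat_mul.
under eq_bigr => j _.
  rewrite mulSn -{1}[(j * p)%N]add0n big_addn addnK big_mkord.
  under eq_bigr => a _.
    rewrite -F_mod addnC modnMDl F_mod natrD mulrDr.
    over.
  rewrite big_split /= -mulr_suml sum0 mul0r add0r.
  over.
by rewrite sumr_const_nat subn0 mulr_natl.
Qed.

(** The analogue of [voronoi_identity] for a character; being of degree 1 in a,
    it is exact. *)
Lemma char_voronoi N c : (p %| N)%N -> coprime c N ->
  (c%:R * F c - 1) * \sum_(a < N) F a * a%:R = F c * N%:R * carry_sum N c F.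
Proof.
move=> p_dvd cop; rewrite mulrBl mul1r.
rewrite -[X in _ - X](@sum_mod_mul _ N c (fun a => F a * a%:R)) //.
rewrite /carry_sum !mulr_sumr -sumrB; apply: eq_bigr => a _.
have -> : F (c * a %% N)%N = F c * F a by rewrite -F_mod modn_dvdm // F_mod FM.
have := congr1 (fun m : nat => m%:R : R) (divn_eq (c * a) N).
rewrite natrD !natrM => /(canLR (addKr _)) <-; ring.
Qed.

End CharacterSums.

(** * A multiplier of order p - 1 *)

Lemma dvdn_pred_exp_Fp (p g m : nat) : prime p -> (0 < g)%N ->
  (p %| g ^ m - 1)%N = (g%:R ^+ m == 1 :> 'F_p).
Proof.
move=> p_pr g_gt0; rewrite (dvdn_pcharf (pchar_Fp p_pr)).
by rewrite natrB ?expn_gt0 ?g_gt0 // subr_eq0 natrX.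
Qed.

Lemma Zp_unit_exp_sub1 (p : primeNum) e (c m : nat) : (0 < e)%N -> (0 < c)%N ->
  c%:R ^+ m != 1 :> 'F_p -> (c%:R ^+ m - 1 : 'Z_(p ^ e)) \is a GRing.unit.
Proof.
move=> e_gt0 c_gt0; have p_pr := prime_valP p.
rewrite -dvdn_pred_exp_Fp // -prime_coprime // => cop.
rewrite -natrX -(natrB _ (_ : 1 <= _)%N) ?expn_gt0 ?c_gt0 //.
by rewrite unitZpE ?expn_prime_gt1 // coprime_pexpl.
Qed.

Lemma Zp_euler (p : primeNum) e a : (0 < e)%N -> coprime a p ->
  a%:R ^+ (p ^ e.-1 * p.-1) = 1 :> 'Z_(p ^ e).
Proof.
move=> e_gt0 cop; have p_pr := prime_valP p.
rewrite mulnC -totient_pfactor // -natrX -[RHS]/(1%:R).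
by apply/Zp_natP => //; apply/eqP/Euler_exp_totient; rewrite coprimeXr.
Qed.

(** The Teichmuller representative modulo p^e of a primitive root. *)
Lemma primitive_root_lift (p : primeNum) e : (0 < e)%N -> exists c : nat,
  [/\ coprime c p, c%:R ^+ p.-1 = 1 :> 'Z_(p ^ e) &
      forall m, (c%:R ^+ m == 1 :> 'F_p) = (p.-1 %| m)%N].
Proof.
move=> e_gt0; have p_pr := prime_valP p.
have [g cop prim_g] := primitive_root_Fp p_pr.
exists (g ^ p ^ e.-1)%N; split=> [||m].
- exact: coprimeXl.
- by rewrite natrX -exprM Zp_euler.
- rewrite natrX -exprM prim_g Gauss_dvdr // coprimeXr //.
  by rewrite coprime_sym coprimenP ?prime_gt0.
Qed.

(** * Units and characteristic of the p-adic integers *)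

Section PadicProjection.
Variables (p : primeNum) (i : nat).

Definition padic_proj (x : 'Zp_[p]) : 'Z_(p ^ i.+1) := x i.

Let projB : zmod_morphism padic_proj. Proof. by []. Qed.
Let projM : monoid_morphism padic_proj. Proof. by []. Qed.

HB.instance Definition _ := GRing.isZmodMorphism.Build _ _ padic_proj projB.
HB.instance Definition _ := GRing.isMonoidMorphism.Build _ _ padic_proj projM.

End PadicProjection.

Section PadicFacts.
Variable p : primeNum.
Let p_pr := prime_valP p.

(** Invertibility modulo p lifts to every p^i, and inverses, being unique, are
    coherent. *)
Lemma padic_unit (x : 'Zp_[p]) : x 0%N \is a GRing.unit -> x \is a GRing.unit.
Proof.
move=> ux0.
have ux i : x i \is a GRing.unit.
  move: ux0; rewrite -(padic_coherent x (leq0n i)) /Zp_red -{2}[x i]natr_Zp.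
  by rewrite !unitZpE ?expn_prime_gt1 // !coprime_pexpl.
pose y : padic_prod p := fun i => (x i)^-1.
have y_coh : y \in @coherent p.
  apply/coherentP => i; apply: (mulIr (ux i)).
  have bnd : (0 < i.+1 <= i.+2)%N by rewrite leqnSn.
  rewrite [RHS]mulVr; last exact: ux.
  rewrite -(padic_coherent x (leqnSn i)) -Zp_redM // mulVr; last exact: ux.
  exact: Zp_red1.
apply/unitrP; exists (PadicInt y_coh).
suff yx : PadicInt y_coh * x = 1 by split; rewrite // mulrC.
apply: val_inj; apply: boolp.functional_extensionality_dep => i.
exact: mulVr (ux i).
Qed.

Lemma padic_natr_neq0 n : (0 < n)%N -> n%:R != 0 :> 'Zp_[p].
Proof.
move=> n_gt0; apply/padic_neq0P; exists n.
have lt_n : (n < p ^ n.+1)%N by apply/ltnW/ltn_expl/prime_gt1.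
rewrite -[(n%:R : 'Zp_[p]) n]/(padic_proj n n%:R) rmorph_nat.
by rewrite val_Zp_nat ?expn_prime_gt1 // modn_small // gtnNdvd.
Qed.

Lemma pchar_Qp : [pchar 'Qp_[p]] =i pred0.
Proof.
apply/pcharf0P => n; rewrite -(rmorph_nat (@tofrac 'Zp_[p])) tofrac_eq0.
by have [-> | /padic_natr_neq0/negPf] := posnP n; rewrite ?eqxx.
Qed.

End PadicFacts.

(** * The number B_(1, chi) for a negative power of the Teichmuller character *)

Section TeichmullerB1.
Variables (p : primeNum) (k : nat).
Hypotheses (p_gt3 : (3 < p)%N) (k_gt0 : (0 < k)%N).
Let p_pr := prime_valP p.
(* The Teichmuller representative of a unit has order dividing p - 1, so its
   powers with exponents - k and k (p - 2) agree. *)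
Let m := (k * p.-2)%N.
Let F a : 'Zp_[p] := teich p a ^+ m.

Let F_mod a : F (a %% p)%N = F a. Proof. by rewrite /F teich_periodic. Qed.
Let FM : {morph F : a b / (a * b)%N >-> a * b}.
Proof. by move=> a b; rewrite /F teichM exprMn. Qed.

Let F_noncoprime a : ~~ coprime a p -> F a = 0.
Proof.
move=> ncop; have : (teich_char p a == 0) by rewrite dchar_eq0.
rewrite tofrac_eq0 => /eqP; rewrite /F => ->.
by rewrite expr0n eqn0Ngt muln_gt0 k_gt0 -subn2 subn_gt0 ltnW.
Qed.

Lemma teich_expN_tofrac a : dchar_expN (teich_char p) k a = tofrac (F a).
Proof.
rewrite /= /dchar_expN_fun; case: ifPn => [cop | /F_noncoprime ->]; last first.
  by rewrite tofrac0.
have t_neq0 : tofrac (teich p a) != 0 :> 'Qp_[p].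
  by rewrite -[tofrac _]/(teich_char p a) dchar_eq0 cop.
apply: (mulfI (expf_neq0 k t_neq0)); rewrite mulfV ?expf_neq0 //.
rewrite -!rmorphXn -rmorphM -exprD /=.
have -> : (k + m = p.-1 * k)%N by rewrite /m; case: (val p) p_gt3 => [|[|q]] //=; lia.
by rewrite exprM teich_unity // expr1n tofrac1.
Qed.

(** Divide the exact identity for the modulus p^e by c chi(c) - 1 in Z_p before
    reducing modulo p^e, where omega(a) becomes a^(p^(e-1)). *)
Lemma teich_B1_voronoi e c : (0 < e)%N -> coprime c p ->
    c%:R ^+ m != 1 :> 'F_p -> c%:R ^+ m.+1 != 1 :> 'F_p ->
  (c%:R ^+ (p ^ e.-1 * m).+1 - 1) *
    Qp_mod e (gen_bernoulli (dchar_expN (teich_char p) k) 1) =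
  c%:R ^+ (p ^ e.-1 * m) *
    carry_sum (p ^ e) c (fun a => a%:R ^+ (p ^ e.-1 * m)) :> 'Z_(p ^ e).
Proof.
move=> e_gt0 cop Fc_neq1 cFc_neq1.
have c_gt0 : (0 < c)%N.
  by case: c cop {Fc_neq1 cFc_neq1} => //; rewrite /coprime gcd0n => /eqP p1;
     move: p_gt3; rewrite p1.
have projF i a : padic_proj i (F a) = a%:R ^+ (p ^ i * m).
  by rewrite /F rmorphXn exprM.
have sum0 : \sum_(a < p) F a = 0.
  apply/eqP; have := char_sum_mul F_mod FM cop => /eqP.
  rewrite -subr_eq0 -{2}[\sum_(a < p) F a]mul1r -mulrBl mulf_eq0.
  case/orP => // /eqP /(congr1 (padic_proj 0)); rewrite rmorphB rmorph1 /= projF.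
  rewrite expn0 mul1n => Fc1; exfalso.
  have := Zp_unit_exp_sub1 (isT : (0 < 1)%N) c_gt0 Fc_neq1.
  by rewrite Fc1 unitr0.
set v := c%:R * F c - 1.
have uv : v \is a GRing.unit.
  apply: padic_unit; rewrite -[v 0%N]/(padic_proj 0 v).
  rewrite rmorphB rmorph1 rmorphM rmorph_nat /= projF expn0 mul1n -exprS.
  exact: Zp_unit_exp_sub1.
(* The identity modulo p^e, with the extra factor p^(e-1) of the first moment
   cancelled. *)
have def_v : v * \sum_(a < p) F a * a%:R = p%:R * (F c * carry_sum (p ^ e) c F).
  have p_neq0 : (p ^ e.-1)%:R != 0 :> 'Zp_[p].
    by rewrite padic_natr_neq0 // expn_gt0 prime_gt0.
  apply: (mulfI p_neq0); rewrite mulrCA -(char_first_moment F_mod) //.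
  rewrite -expnSr prednK // (char_voronoi F_mod FM) ?dvdn_exp ?coprimeXr //.
  by rewrite -{1}(prednK e_gt0) expnSr natrM; ring.
have p_neq0 : p%:R != 0 :> 'Qp_[p].
  by rewrite -(rmorph_nat (@tofrac 'Zp_[p])) tofrac_eq0 padic_natr_neq0 ?prime_gt0.
have F0 : F 0%N = 0 by apply: F_noncoprime; rewrite /coprime gcd0n; case: eqP p_gt3 => // ->.
have Fp : F p = 0 by rewrite -F_mod modnn.
have sum_shift (G : nat -> 'Zp_[p]) : G 0%N = 0 -> G p = 0 ->
    \sum_(1 <= a < p.+1) tofrac (G a) = tofrac (\sum_(a < p) G a) :> 'Qp_[p].
  move=> G0 Gp; rewrite rmorph_sum -(big_mkord xpredT (fun a => tofrac (G a))) /=.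
  rewrite big_nat_recr ?prime_gt0 //= Gp tofrac0 addr0.
  by rewrite [RHS]big_ltn ?prime_gt0 // G0 tofrac0 add0r.
have -> : gen_bernoulli (dchar_expN (teich_char p) k) 1 =
    tofrac (v^-1 * (F c * carry_sum (p ^ e) c F)).
  rewrite gen_bernoulli1E ?prime_gt0 //; [|exact: pchar_Qp|]; last first.
    by under eq_bigr do rewrite teich_expN_tofrac; rewrite sum_shift // sum0 tofrac0.
  apply: (mulfI p_neq0); rewrite mulVKf //.
  under eq_bigr do rewrite teich_expN_tofrac -(rmorph_nat (@tofrac 'Zp_[p])) -rmorphM.
  rewrite (sum_shift (fun a => F a * a%:R)) ?F0 ?Fp ?mul0r //.
  rewrite -(rmorph_nat (@tofrac 'Zp_[p])) -rmorphM; congr tofrac.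
  by rewrite mulrCA -def_v mulKr.
rewrite Qp_mod_tofrac; case: e e_gt0 @v uv {def_v} => // e _ v uv.
rewrite padic_modE -[X in _ * X]/(padic_proj e _).
have -> : c%:R ^+ (p ^ e * m).+1 - 1 = padic_proj e v.
  by rewrite rmorphB rmorph1 rmorphM rmorph_nat /= projF -exprS.
rewrite -rmorphM mulVKr // rmorphM /= projF rmorph_carry_sum; congr (_ * _).
by apply: eq_bigr => a _; congr (_ * _); apply: projF.
Qed.

End TeichmullerB1.

(** * Comparison of the two sides *)

Section Comparison.
Variables (p : primeNum) (k : nat).
(* The bound gives p > 3, makes p - k and k - 1 smaller than p - 1, and makes
   p - k - 1 at least 2, so that powers of multiples of p vanish modulo p^2. *)
Hypotheses (k_gt1 : (1 < k)%N) (lt_kp : (k + 5 < p)%N).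
Let p_pr := prime_valP p.
Let m := (k * p.-2)%N.

Lemma Zp_unit_nat e a : (0 < e)%N -> coprime a p ->
  (a%:R : 'Z_(p ^ e)) \is a GRing.unit.
Proof.
by move=> e_gt0 cop; rewrite unitZpE ?expn_prime_gt1 // coprime_pexpl // coprime_sym.
Qed.

Lemma exp_dvd_eq1 (R : pzSemiRingType) (x : R) d n :
  x ^+ d = 1 -> (d %| n)%N -> x ^+ n = 1.
Proof. by move=> xd /dvdnP[q ->]; rewrite mulnC exprM xd expr1n. Qed.

(** Since p = 1 modulo p - 1, the exponent p^j k (p - 2), which represents
    omega^(-k), is - k modulo p - 1. *)
Lemma dvdn_teich_exponent j : (p.-1 %| p ^ j * m + k)%N.
Proof.
have p1 : (p ^ j %% p.-1 = 1 %% p.-1)%N.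
  have p1 : (p %% p.-1 = 1 %% p.-1)%N.
    by rewrite -{1}(prednK (prime_gt0 p_pr)) -addn1 modnDl.
  by rewrite -modnXm p1 modnXm exp1n.
rewrite /dvdn -modnDml -modnMml p1 modnMml modnDml mul1n /m.
have -> : (k * p.-2 + k = k * p.-1)%N by lia.
by rewrite modnMl.
Qed.

(** The condition on n says that n - 1 = - k modulo p - 1, so that c^(n-1) is
    the value of the character at c and all identities share the factors u and
    w. *)
Lemma common_voronoi e : (0 < e)%N ->
  exists c : nat, exists u w : 'Z_(p ^ e), [/\ u \is a GRing.unit,
    u * Qp_mod e (gen_bernoulli (dchar_expN (teich_char p) k) 1) =
      w * carry_sum (p ^ e) c (fun a => a%:R ^+ (p ^ e.-1 * m)) &
    forall n, (0 < n)%N -> (p.-1 %| n.-1 + k)%N -> coprime p n ->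
      u * ratr (bernoulli_hat n) =
        w * carry_sum (p ^ e) c (fun a => a%:R ^+ n.-1)].
Proof.
move=> e_gt0; have p_gt3 : (3 < p)%N by lia.
have [c [cop c_ord prim_c]] := primitive_root_lift p e_gt0.
have c_gt0 : (0 < c)%N.
  by case: c cop {c_ord prim_c} => //; rewrite /coprime gcd0n; lia.
have ndvd_k : ~~ (p.-1 %| k)%N by rewrite gtnNdvd //; lia.
have ndvd_k1 : ~~ (p.-1 %| k.-1)%N by rewrite gtnNdvd //; lia.
have dvd_m j := dvdn_teich_exponent j.
have ndvd_lt j : (p.-1 %| j + k)%N -> ~~ (p.-1 %| j)%N.
  by move=> dvd_jk; apply: contra ndvd_k => dvd_j; rewrite -(dvdn_addr _ dvd_j).
have ndvd_ltS j : (p.-1 %| j + k)%N -> ~~ (p.-1 %| j.+1)%N.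
  move=> dvd_jk; apply: contra ndvd_k1 => dvd_j; rewrite -(dvdn_addr _ dvd_j).
  by have -> : (j.+1 + k.-1 = j + k)%N by lia.
have dvd_m0 : (p.-1 %| m + k)%N by have := dvd_m 0%N; rewrite mul1n.
exists c, (c%:R ^+ (p ^ e.-1 * m).+1 - 1), (c%:R ^+ (p ^ e.-1 * m)); split.
- by apply: Zp_unit_exp_sub1 => //; rewrite prim_c ndvd_ltS.
- apply: teich_B1_voronoi => //; first exact: ltnW.
    by rewrite prim_c; apply: ndvd_lt.
  by rewrite prim_c; apply: ndvd_ltS.
move=> n n_gt0 dvd_n cop_n.
have c_exp : c%:R ^+ (p ^ e.-1 * m) = c%:R ^+ n.-1 :> 'Z_(p ^ e).
  apply: (mulIr (unitrX k (Zp_unit_nat e_gt0 cop))).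
  by rewrite -!exprD !(exp_dvd_eq1 c_ord).
rewrite [_ ^+ _.+1]exprS c_exp -exprS prednK //.
apply: bernoulli_hat_voronoi => //; last exact: ndvd_lt.
by rewrite -(prednK n_gt0) ndvd_ltS.
Qed.

Lemma Zp_exp_eq0 e a n : (0 < e)%N -> (e <= n)%N -> ~~ coprime a p ->
  a%:R ^+ n = 0 :> 'Z_(p ^ e).
Proof.
move=> e_gt0 le_en; rewrite coprime_sym prime_coprime // negbK => p_dvd.
rewrite -natrX -[RHS]/(0%:R); apply/Zp_natP => //; rewrite mod0n.
by apply: dvdn_trans (dvdn_exp2l _ le_en) (dvdn_exp2r _ p_dvd).
Qed.

Lemma teich_exponent_mod1 a :
  a%:R ^+ (p ^ 0 * m) = a%:R ^+ (p - k).-1 :> 'Z_(p ^ 1).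
Proof.
have [cop | ncop] := boolP (coprime a p); last first.
  by rewrite !Zp_exp_eq0 //; rewrite /m; nia.
apply: (mulIr (unitrX k (@Zp_unit_nat 1 a isT cop))).
have a1 : a%:R ^+ p.-1 = 1 :> 'Z_(p ^ 1) by have := @Zp_euler p 1 a isT cop; rewrite mul1n.
rewrite -!exprD !(exp_dvd_eq1 a1) ?dvdn_teich_exponent //.
by have -> : ((p - k).-1 + k = p.-1)%N by lia.
Qed.

(** After multiplication by a^(pk) all exponents are multiples of p - 1, and
    both sides become polynomials of degree at most 1 in t = a^(p-1) - 1, whose
    square is 0. *)
Lemma teich_exponent_mod2 a :
  a%:R ^+ (p ^ 1 * m) =
    (k + 2)%:R * a%:R ^+ (p - k).-1
    - (k + 1)%:R * a%:R ^+ (2 * p - k - 1).-1 :> 'Z_(p ^ 2).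
Proof.
have [cop | ncop] := boolP (coprime a p); last first.
  by rewrite !Zp_exp_eq0 ?mulr0 ?subrr //; rewrite /m; nia.
have ua := @Zp_unit_nat 2 a isT cop.
pose t : 'Z_(p ^ 2) := a%:R ^+ p.-1 - 1.
have t2 : t ^+ 2 = 0.
  have a_gt0 : (0 < a)%N by case: a cop {t ua} => //; rewrite /coprime gcd0n; lia.
  rewrite /t -natrX -(natrB _ (_ : 1 <= _)%N) ?expn_gt0 ?a_gt0 //.
  apply: Zp_exp_eq0 => //; rewrite coprime_sym prime_coprime // negbK.
  rewrite -eqn_mod_dvd ?expn_gt0 ?a_gt0 //.
  by have := Euler_exp_totient cop; rewrite totient_prime // => ->.
have expt j : (a%:R : 'Z_(p ^ 2)) ^+ (p.-1 * j) = 1 + t *+ j.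
  have [z] := expr_add_mod_sqr 1 t j; rewrite t2 mul0r addr0 !expr1n mul1r => <-.
  by rewrite exprM /t addrCA subrr addr0.
apply: (mulIr (unitrX (p * k) ua)).
rewrite mulrBl -!mulrA -!exprD.
have -> : (p ^ 1 * m + p * k = p ^ 1 * p.-1 * k)%N by rewrite /m; nia.
rewrite exprM Zp_euler // expr1n.
have -> : ((p - k).-1 + p * k = p.-1 * (k + 1))%N by nia.
have -> : ((2 * p - k - 1).-1 + p * k = p.-1 * (k + 2))%N by nia.
by rewrite !expt -[t *+ (k + 1)]mulr_natr -[t *+ (k + 2)]mulr_natr !natrD; ring.
Qed.

Lemma B1_teich_mod2 :
  Qp_mod 2 (gen_bernoulli (dchar_expN (teich_char p) k) 1) =
    (k + 2)%:R * ratr (bernoulli_hat (p - k))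
    - (k + 1)%:R * ratr (bernoulli_hat (2 * p - k - 1)) :> 'Z_(p ^ 2).
Proof.
have [c [u [w [uu def_B def_H]]]] := @common_voronoi 2 isT.
have H1 := def_H (p - k)%N; have H2 := def_H (2 * p - k - 1)%N.
apply: (mulrI uu); rewrite def_B mulrBr 2![u * (_%:R * _)]mulrCA H1 ?H2.
- rewrite 2![_%:R * (w * _)]mulrCA -mulrBr; congr (_ * _).
  rewrite /carry_sum !mulr_sumr -sumrB; apply: eq_bigr => a _.
  by rewrite teich_exponent_mod2 mulrBl !mulrA.
- lia.
- have -> : ((2 * p - k - 1).-1 + k = p.-1 * 2)%N by lia.
  exact: dvdn_mulr.
- have -> : (2 * p - k - 1 = p + (p - k - 1))%N by lia.
  by rewrite prime_coprime // dvdn_addr // gtnNdvd //; lia.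
- lia.
- by have -> : ((p - k).-1 + k = p.-1)%N by lia.
- by rewrite prime_coprime // gtnNdvd //; lia.
Qed.

Lemma B1_teich_mod1 :
  Qp_mod 1 (gen_bernoulli (dchar_expN (teich_char p) k) 1) =
    ratr (bernoulli_hat (p - k)) :> 'Z_(p ^ 1).
Proof.
have [c [u [w [uu def_B def_H]]]] := @common_voronoi 1 isT.
apply: (mulrI uu); rewrite def_B def_H; first 1 last.
- lia.
- by have -> : ((p - k).-1 + k = p.-1)%N by lia.
- by rewrite prime_coprime // gtnNdvd //; lia.
by congr (_ * _); apply: eq_bigr => a _; rewrite teich_exponent_mod1.
Qed.

End Comparison.

Unset Implicit Arguments.

Theorem corollaryA3 (k : nat) (hk : (2 <= k)%N) :
  calA_of (fun p : primeNum =>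
      Qp_mod 2 (gen_bernoulli (dchar_expN (teich_char p) k) 1))
    = (k + 2)%:R *
        calA_of (fun p : primeNum => ratr (bernoulli_hat (p - k)) : 'Z_(p ^ 2))
      - (k + 1)%:R *
        calA_of (fun p : primeNum =>
          ratr (bernoulli_hat (2 * p - k - 1)) : 'Z_(p ^ 2))
    :> calA 2
  /\
  calA_of (fun p : primeNum =>
      Qp_mod 1 (gen_bernoulli (dchar_expN (teich_char p) k) 1))
    = calA_of (fun p : primeNum => ratr (bernoulli_hat (p - k)) : 'Z_(p ^ 1))
    :> calA 1.
Proof.
split.
  rewrite !calA_of_nat !calA_ofM calA_ofN calA_ofD; apply/calA_ofP.
  by exists (k + 5)%N => p lt_p; apply: B1_teich_mod2.
by apply/calA_ofP; exists (k + 5)%N => p lt_p; apply: B1_teich_mod1.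
Qed.
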